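(* Work in intensional Martin-Löf type theory with propositional truncation satisfying the judgmental computation rule $\mathrm{rec}(P,h,f,|x|)\equiv f(x)$. Let $X:\mathcal U$ be a type with a given element $x_0:X$ which is transitive, i.e. $\prod_{x,y:X}(X,x)=_{\mathcal U_\bullet}(X,y)$. Then there is a term $\mathrm{myst}_X$ of a type of the form $\prod_{z:\lVert X\rVert}B(z)$, for some family $B:\lVert X\rVert\to\mathcal U$ with $B(|x|)\equiv X$ judgmentally for variables $x:X$, such that the composite $\lambda x.\,\mathrm{myst}_X(|x|):X\to X$ type-checks and $\mathrm{myst}_X(|x|)\equiv x$ judgmentally; that is, $p(x):\equiv\mathsf{refl}_x$ defines a term $p:\prod_{x:X}\mathrm{myst}_X(|x|)=_X x$.
   Context: Intensional Martin-Löf type theory with a universe $\mathcal U$ (and a larger universe containing it), $\Sigma$, $\Pi$, $+$, identity types (J only; no UIP/K) and judgmental $\eta$ for functions. $\mathcal U_\bullet:\equiv\sum_{X:\mathcal U}X$ is the type of pointed types. $\mathrm{isProp}(A):\equiv\prod_{a,b:A}a=b$. Propositional truncation: for every type $A$ a type $\lVert A\rVert$ with $|{-}|:A\to\lVert A\rVert$, a proof of $\mathrm{isProp}(\lVert A\rVert)$, and $\mathrm{rec}:\prod_{P}\mathrm{isProp}(P)\to(A\to P)\to\lVert A\rVert\to P$ (eliminating into types of the relevant universes), with $\mathrm{rec}(P,h,f,|x|)\equiv f(x)$ judgmentally. *)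

(* Defs.v *)
(** Judgmental equality is a relation between terms of the object theory and
    cannot be asserted by a proposition of Rocq about Rocq's own terms.  So the
    type theory is given here as a formal system: raw terms and inductively
    generated judgments.  [≡] below is the judgmental equality of that system;
    the identity type is the term former [Id]. *)

(** [U1] is the larger universe, containing [U0] both as an element and as a
    subuniverse.  Universes are à la Russell. *)
Inductive level : Set := U0 | U1.

(** De Bruijn syntax.  The number of variables bound in each argument:
    [Pi A B], [Lam A b], [Sig A B] bind 1 in [B], [b], [B];
    [Pair A B a b] binds 1 in [B];
    [SigInd A B C g p] binds 1 in [B], 1 in [C] and 2 in [g];
    [SumInd A B C c d e] binds 1 in each of [C], [c], [d];
    [J A C c a b p] binds 3 in [C] and 1 in [c]. *)
Inductive term : Set :=
| Var (n : nat)
| Univ (l : level)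
| Pi (A B : term)
| Lam (A b : term)
| App (f a : term)
| Sig (A B : term)
| Pair (A B a b : term)
| SigInd (A B C g p : term)
| Sum (A B : term)
| Inl (A B a : term)
| Inr (A B b : term)
| SumInd (A B C c d e : term)
| Id (A a b : term)
| Refl (A a : term)
| J (A C c a b p : term)
| Trunc (A : term)
| Tr (A a : term)
| TruncIsProp (A : term)
| TruncRec (A P h f z : term).

Definition scons {T : Type} (x : T) (s : nat -> T) (n : nat) : T :=
  match n with 0 => x | S m => s m end.
Notation "x .: s" := (scons x s) (at level 55, right associativity).

Definition upr (r : nat -> nat) : nat -> nat := 0 .: (fun n => S (r n)).

Fixpoint ren (r : nat -> nat) (t : term) : term :=
  match t with
  | Var n => Var (r n)
  | Univ l => Univ l
  | Pi A B => Pi (ren r A) (ren (upr r) B)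
  | Lam A b => Lam (ren r A) (ren (upr r) b)
  | App f a => App (ren r f) (ren r a)
  | Sig A B => Sig (ren r A) (ren (upr r) B)
  | Pair A B a b => Pair (ren r A) (ren (upr r) B) (ren r a) (ren r b)
  | SigInd A B C g p =>
      SigInd (ren r A) (ren (upr r) B) (ren (upr r) C)
        (ren (upr (upr r)) g) (ren r p)
  | Sum A B => Sum (ren r A) (ren r B)
  | Inl A B a => Inl (ren r A) (ren r B) (ren r a)
  | Inr A B b => Inr (ren r A) (ren r B) (ren r b)
  | SumInd A B C c d e =>
      SumInd (ren r A) (ren r B) (ren (upr r) C)
        (ren (upr r) c) (ren (upr r) d) (ren r e)
  | Id A a b => Id (ren r A) (ren r a) (ren r b)
  | Refl A a => Refl (ren r A) (ren r a)
  | J A C c a b p =>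
      J (ren r A) (ren (upr (upr (upr r))) C) (ren (upr r) c)
        (ren r a) (ren r b) (ren r p)
  | Trunc A => Trunc (ren r A)
  | Tr A a => Tr (ren r A) (ren r a)
  | TruncIsProp A => TruncIsProp (ren r A)
  | TruncRec A P h f z =>
      TruncRec (ren r A) (ren r P) (ren r h) (ren r f) (ren r z)
  end.

Notation "↑ t" := (ren S t) (at level 9, right associativity, t at level 9).

Definition up (s : nat -> term) : nat -> term := Var 0 .: (fun n => ↑(s n)).

Fixpoint subst (s : nat -> term) (t : term) : term :=
  match t with
  | Var n => s n
  | Univ l => Univ l
  | Pi A B => Pi (subst s A) (subst (up s) B)
  | Lam A b => Lam (subst s A) (subst (up s) b)
  | App f a => App (subst s f) (subst s a)
  | Sig A B => Sig (subst s A) (subst (up s) B)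
  | Pair A B a b => Pair (subst s A) (subst (up s) B) (subst s a) (subst s b)
  | SigInd A B C g p =>
      SigInd (subst s A) (subst (up s) B) (subst (up s) C)
        (subst (up (up s)) g) (subst s p)
  | Sum A B => Sum (subst s A) (subst s B)
  | Inl A B a => Inl (subst s A) (subst s B) (subst s a)
  | Inr A B b => Inr (subst s A) (subst s B) (subst s b)
  | SumInd A B C c d e =>
      SumInd (subst s A) (subst s B) (subst (up s) C)
        (subst (up s) c) (subst (up s) d) (subst s e)
  | Id A a b => Id (subst s A) (subst s a) (subst s b)
  | Refl A a => Refl (subst s A) (subst s a)
  | J A C c a b p =>
      J (subst s A) (subst (up (up (up s))) C) (subst (up s) c)
        (subst s a) (subst s b) (subst s p)
  | Trunc A => Trunc (subst s A)
  | Tr A a => Tr (subst s A) (subst s a)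
  | TruncIsProp A => TruncIsProp (subst s A)
  | TruncRec A P h f z =>
      TruncRec (subst s A) (subst s P) (subst s h) (subst s f) (subst s z)
  end.

Notation "t .[ s ]" := (subst s t) (at level 2, left associativity, s at level 200).
Notation "t .[ a /]" := (subst (a .: Var) t)
  (at level 2, left associativity, a at level 200).

Definition Arr (A B : term) : term := Pi A (↑B).

Definition IsProp (A : term) : term :=
  Pi A (Pi (↑A) (Id (↑↑A) (Var 1) (Var 0))).

(** [𝒰_•] and its element [(A, a)]. *)
Definition PtType : term := Sig (Univ U0) (Var 0).
Definition Pt (A a : term) : term := Pair (Univ U0) (Var 0) A a.

Definition Transitive (X : term) : term :=
  Pi X (Pi (↑X) (Id PtType (Pt (↑↑X) (Var 1)) (Pt (↑↑X) (Var 0)))).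

(** The most recently declared variable comes first. *)
Definition ctx : Set := list term.

(** [lookup Γ n A]: the variable [n] has type [A], where [A] is a term over
    the whole of [Γ]. *)
Inductive lookup : ctx -> nat -> term -> Prop :=
| lookup_here Γ A : lookup (cons A Γ) 0 (↑A)
| lookup_there Γ A B n : lookup Γ n A -> lookup (cons B Γ) (S n) (↑A).

Inductive judgment : Set :=
| WfCtx
| IsType (A : term)
| EqType (A B : term)
| HasType (a A : term)
| EqTerm (a b A : term).

(** Formation rules hold alike for types and for elements of each universe:
    [None] stands for "is a type", [Some l] for "is an element of [Univ l]". *)
Definition isA (s : option level) (A : term) : judgment :=
  match s with None => IsType A | Some l => HasType A (Univ l) end.
Definition eqA (s : option level) (A B : term) : judgment :=
  match s with None => EqType A B | Some l => EqTerm A B (Univ l) end.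

Reserved Notation "Γ ⊢ j" (at level 70, j at level 69, no associativity).
Reserved Notation "[ ⊢ Γ ]" (at level 0, Γ at level 60).
Reserved Notation "[ Γ ⊢ A ]" (at level 0, Γ at level 60, A at level 60).
Reserved Notation "[ Γ ⊢ A ≡ B ]"
  (at level 0, Γ at level 60, A at level 60, B at level 60).
Reserved Notation "[ Γ ⊢ a : A ]"
  (at level 0, Γ at level 60, a at level 60, A at level 60).
Reserved Notation "[ Γ ⊢ a ≡ b : A ]"
  (at level 0, Γ at level 60, a at level 60, b at level 60, A at level 60).
Notation "Γ ,, A" := (@cons term A Γ) (at level 58, left associativity).

Inductive derivable : ctx -> judgment -> Prop :=

| ctx_nil : [ ⊢ nil ]
| ctx_cons Γ A : [ ⊢ Γ ] -> [ Γ ⊢ A ] -> [ ⊢ Γ ,, A ]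
| var_intro Γ n A : [ ⊢ Γ ] -> lookup Γ n A -> [ Γ ⊢ Var n : A ]

| ty_refl Γ A : [ Γ ⊢ A ] -> [ Γ ⊢ A ≡ A ]
| ty_sym Γ A B : [ Γ ⊢ A ≡ B ] -> [ Γ ⊢ B ≡ A ]
| ty_trans Γ A B C : [ Γ ⊢ A ≡ B ] -> [ Γ ⊢ B ≡ C ] -> [ Γ ⊢ A ≡ C ]
| tm_refl Γ a A : [ Γ ⊢ a : A ] -> [ Γ ⊢ a ≡ a : A ]
| tm_sym Γ a b A : [ Γ ⊢ a ≡ b : A ] -> [ Γ ⊢ b ≡ a : A ]
| tm_trans Γ a b c A :
    [ Γ ⊢ a ≡ b : A ] -> [ Γ ⊢ b ≡ c : A ] -> [ Γ ⊢ a ≡ c : A ]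
| tm_conv Γ a A B : [ Γ ⊢ a : A ] -> [ Γ ⊢ A ≡ B ] -> [ Γ ⊢ a : B ]
| tm_eq_conv Γ a b A B :
    [ Γ ⊢ a ≡ b : A ] -> [ Γ ⊢ A ≡ B ] -> [ Γ ⊢ a ≡ b : B ]

| univ_type Γ l : [ ⊢ Γ ] -> [ Γ ⊢ Univ l ]
| univ_in Γ : [ ⊢ Γ ] -> [ Γ ⊢ Univ U0 : Univ U1 ]
| univ_el Γ A l : [ Γ ⊢ A : Univ l ] -> [ Γ ⊢ A ]
| univ_el_eq Γ A B l : [ Γ ⊢ A ≡ B : Univ l ] -> [ Γ ⊢ A ≡ B ]
| univ_cumul Γ A : [ Γ ⊢ A : Univ U0 ] -> [ Γ ⊢ A : Univ U1 ]
| univ_cumul_eq Γ A B :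
    [ Γ ⊢ A ≡ B : Univ U0 ] -> [ Γ ⊢ A ≡ B : Univ U1 ]

| pi_form Γ s A B :
    [ Γ ⊢ A ] -> Γ ⊢ isA s A -> Γ ,, A ⊢ isA s B -> Γ ⊢ isA s (Pi A B)
| pi_cong Γ s A A' B B' :
    [ Γ ⊢ A ] -> Γ ⊢ eqA s A A' -> Γ ,, A ⊢ eqA s B B' ->
    Γ ⊢ eqA s (Pi A B) (Pi A' B')
| lam_intro Γ A B b :
    [ Γ ⊢ A ] -> [ Γ ,, A ⊢ b : B ] -> [ Γ ⊢ Lam A b : Pi A B ]
| lam_cong Γ A A' B b b' :
    [ Γ ⊢ A ] -> [ Γ ⊢ A ≡ A' ] -> [ Γ ,, A ⊢ b ≡ b' : B ] ->
    [ Γ ⊢ Lam A b ≡ Lam A' b' : Pi A B ]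
| app_elim Γ A B f a :
    [ Γ ⊢ f : Pi A B ] -> [ Γ ⊢ a : A ] -> [ Γ ⊢ App f a : B.[a/] ]
| app_cong Γ A B f f' a a' :
    [ Γ ⊢ f ≡ f' : Pi A B ] -> [ Γ ⊢ a ≡ a' : A ] ->
    [ Γ ⊢ App f a ≡ App f' a' : B.[a/] ]
| pi_beta Γ A B b a :
    [ Γ ⊢ A ] -> [ Γ ,, A ⊢ b : B ] -> [ Γ ⊢ a : A ] ->
    [ Γ ⊢ App (Lam A b) a ≡ b.[a/] : B.[a/] ]
| pi_eta Γ A B f :
    [ Γ ⊢ f : Pi A B ] -> [ Γ ⊢ f ≡ Lam A (App (↑f) (Var 0)) : Pi A B ]

| sig_form Γ s A B :
    [ Γ ⊢ A ] -> Γ ⊢ isA s A -> Γ ,, A ⊢ isA s B -> Γ ⊢ isA s (Sig A B)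
| sig_cong Γ s A A' B B' :
    [ Γ ⊢ A ] -> Γ ⊢ eqA s A A' -> Γ ,, A ⊢ eqA s B B' ->
    Γ ⊢ eqA s (Sig A B) (Sig A' B')
| pair_intro Γ A B a b :
    [ Γ ⊢ A ] -> [ Γ ,, A ⊢ B ] -> [ Γ ⊢ a : A ] -> [ Γ ⊢ b : B.[a/] ] ->
    [ Γ ⊢ Pair A B a b : Sig A B ]
| pair_cong Γ A A' B B' a a' b b' :
    [ Γ ⊢ A ] -> [ Γ ⊢ A ≡ A' ] -> [ Γ ,, A ⊢ B ≡ B' ] ->
    [ Γ ⊢ a ≡ a' : A ] -> [ Γ ⊢ b ≡ b' : B.[a/] ] ->
    [ Γ ⊢ Pair A B a b ≡ Pair A' B' a' b' : Sig A B ]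
| sig_elim Γ A B C g p :
    [ Γ ⊢ A ] -> [ Γ ,, A ⊢ B ] -> [ Γ ,, Sig A B ⊢ C ] ->
    [ Γ ,, A ,, B ⊢ g : C.[Pair (↑↑A) (ren (upr (fun n => S (S n))) B)
                             (Var 1) (Var 0) .: (fun n => Var (S (S n)))] ] ->
    [ Γ ⊢ p : Sig A B ] ->
    [ Γ ⊢ SigInd A B C g p : C.[p/] ]
| sig_elim_cong Γ A A' B B' C C' g g' p p' :
    [ Γ ⊢ A ] -> [ Γ ,, A ⊢ B ] ->
    [ Γ ⊢ A ≡ A' ] -> [ Γ ,, A ⊢ B ≡ B' ] -> [ Γ ,, Sig A B ⊢ C ≡ C' ] ->
    [ Γ ,, A ,, B ⊢ g ≡ g' : C.[Pair (↑↑A) (ren (upr (fun n => S (S n))) B)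
                             (Var 1) (Var 0) .: (fun n => Var (S (S n)))] ] ->
    [ Γ ⊢ p ≡ p' : Sig A B ] ->
    [ Γ ⊢ SigInd A B C g p ≡ SigInd A' B' C' g' p' : C.[p/] ]
| sig_beta Γ A B C g a b :
    [ Γ ⊢ A ] -> [ Γ ,, A ⊢ B ] -> [ Γ ,, Sig A B ⊢ C ] ->
    [ Γ ,, A ,, B ⊢ g : C.[Pair (↑↑A) (ren (upr (fun n => S (S n))) B)
                             (Var 1) (Var 0) .: (fun n => Var (S (S n)))] ] ->
    [ Γ ⊢ a : A ] -> [ Γ ⊢ b : B.[a/] ] ->
    [ Γ ⊢ SigInd A B C g (Pair A B a b) ≡ g.[b .: a .: Var]
        : C.[Pair A B a b/] ]

| sum_form Γ s A B :
    Γ ⊢ isA s A -> Γ ⊢ isA s B -> Γ ⊢ isA s (Sum A B)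
| sum_cong Γ s A A' B B' :
    Γ ⊢ eqA s A A' -> Γ ⊢ eqA s B B' -> Γ ⊢ eqA s (Sum A B) (Sum A' B')
| inl_intro Γ A B a :
    [ Γ ⊢ A ] -> [ Γ ⊢ B ] -> [ Γ ⊢ a : A ] -> [ Γ ⊢ Inl A B a : Sum A B ]
| inl_cong Γ A A' B B' a a' :
    [ Γ ⊢ A ≡ A' ] -> [ Γ ⊢ B ≡ B' ] -> [ Γ ⊢ a ≡ a' : A ] ->
    [ Γ ⊢ Inl A B a ≡ Inl A' B' a' : Sum A B ]
| inr_intro Γ A B b :
    [ Γ ⊢ A ] -> [ Γ ⊢ B ] -> [ Γ ⊢ b : B ] -> [ Γ ⊢ Inr A B b : Sum A B ]
| inr_cong Γ A A' B B' b b' :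
    [ Γ ⊢ A ≡ A' ] -> [ Γ ⊢ B ≡ B' ] -> [ Γ ⊢ b ≡ b' : B ] ->
    [ Γ ⊢ Inr A B b ≡ Inr A' B' b' : Sum A B ]
| sum_elim Γ A B C c d e :
    [ Γ ⊢ A ] -> [ Γ ⊢ B ] -> [ Γ ,, Sum A B ⊢ C ] ->
    [ Γ ,, A ⊢ c : C.[Inl (↑A) (↑B) (Var 0) .: (fun n => Var (S n))] ] ->
    [ Γ ,, B ⊢ d : C.[Inr (↑A) (↑B) (Var 0) .: (fun n => Var (S n))] ] ->
    [ Γ ⊢ e : Sum A B ] ->
    [ Γ ⊢ SumInd A B C c d e : C.[e/] ]
| sum_elim_cong Γ A A' B B' C C' c c' d d' e e' :
    [ Γ ⊢ A ] -> [ Γ ⊢ B ] ->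
    [ Γ ⊢ A ≡ A' ] -> [ Γ ⊢ B ≡ B' ] -> [ Γ ,, Sum A B ⊢ C ≡ C' ] ->
    [ Γ ,, A ⊢ c ≡ c' : C.[Inl (↑A) (↑B) (Var 0) .: (fun n => Var (S n))] ] ->
    [ Γ ,, B ⊢ d ≡ d' : C.[Inr (↑A) (↑B) (Var 0) .: (fun n => Var (S n))] ] ->
    [ Γ ⊢ e ≡ e' : Sum A B ] ->
    [ Γ ⊢ SumInd A B C c d e ≡ SumInd A' B' C' c' d' e' : C.[e/] ]
| sum_beta_l Γ A B C c d a :
    [ Γ ⊢ A ] -> [ Γ ⊢ B ] -> [ Γ ,, Sum A B ⊢ C ] ->
    [ Γ ,, A ⊢ c : C.[Inl (↑A) (↑B) (Var 0) .: (fun n => Var (S n))] ] ->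
    [ Γ ,, B ⊢ d : C.[Inr (↑A) (↑B) (Var 0) .: (fun n => Var (S n))] ] ->
    [ Γ ⊢ a : A ] ->
    [ Γ ⊢ SumInd A B C c d (Inl A B a) ≡ c.[a/] : C.[Inl A B a/] ]
| sum_beta_r Γ A B C c d b :
    [ Γ ⊢ A ] -> [ Γ ⊢ B ] -> [ Γ ,, Sum A B ⊢ C ] ->
    [ Γ ,, A ⊢ c : C.[Inl (↑A) (↑B) (Var 0) .: (fun n => Var (S n))] ] ->
    [ Γ ,, B ⊢ d : C.[Inr (↑A) (↑B) (Var 0) .: (fun n => Var (S n))] ] ->
    [ Γ ⊢ b : B ] ->
    [ Γ ⊢ SumInd A B C c d (Inr A B b) ≡ d.[b/] : C.[Inr A B b/] ]

(* In the motive [C] of [J], variables 2, 1 and 0 are the two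
   endpoints and the identification *)
| id_form Γ s A a b :
    Γ ⊢ isA s A -> [ Γ ⊢ a : A ] -> [ Γ ⊢ b : A ] -> Γ ⊢ isA s (Id A a b)
| id_cong Γ s A A' a a' b b' :
    Γ ⊢ eqA s A A' -> [ Γ ⊢ a ≡ a' : A ] -> [ Γ ⊢ b ≡ b' : A ] ->
    Γ ⊢ eqA s (Id A a b) (Id A' a' b')
| refl_intro Γ A a : [ Γ ⊢ A ] -> [ Γ ⊢ a : A ] -> [ Γ ⊢ Refl A a : Id A a a ]
| refl_cong Γ A A' a a' :
    [ Γ ⊢ A ≡ A' ] -> [ Γ ⊢ a ≡ a' : A ] ->
    [ Γ ⊢ Refl A a ≡ Refl A' a' : Id A a a ]
| id_elim Γ A C c a b p :
    [ Γ ⊢ A ] ->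
    [ Γ ,, A ,, ↑A ,, Id (↑↑A) (Var 1) (Var 0) ⊢ C ] ->
    [ Γ ,, A ⊢ c : C.[Refl (↑A) (Var 0) .: Var 0 .: Var 0
                        .: (fun n => Var (S n))] ] ->
    [ Γ ⊢ a : A ] -> [ Γ ⊢ b : A ] -> [ Γ ⊢ p : Id A a b ] ->
    [ Γ ⊢ J A C c a b p : C.[p .: b .: a .: Var] ]
| id_elim_cong Γ A A' C C' c c' a a' b b' p p' :
    [ Γ ⊢ A ] -> [ Γ ⊢ A ≡ A' ] ->
    [ Γ ,, A ,, ↑A ,, Id (↑↑A) (Var 1) (Var 0) ⊢ C ≡ C' ] ->
    [ Γ ,, A ⊢ c ≡ c' : C.[Refl (↑A) (Var 0) .: Var 0 .: Var 0
                             .: (fun n => Var (S n))] ] ->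
    [ Γ ⊢ a ≡ a' : A ] -> [ Γ ⊢ b ≡ b' : A ] -> [ Γ ⊢ p ≡ p' : Id A a b ] ->
    [ Γ ⊢ J A C c a b p ≡ J A' C' c' a' b' p' : C.[p .: b .: a .: Var] ]
| id_beta Γ A C c a :
    [ Γ ⊢ A ] ->
    [ Γ ,, A ,, ↑A ,, Id (↑↑A) (Var 1) (Var 0) ⊢ C ] ->
    [ Γ ,, A ⊢ c : C.[Refl (↑A) (Var 0) .: Var 0 .: Var 0
                        .: (fun n => Var (S n))] ] ->
    [ Γ ⊢ a : A ] ->
    [ Γ ⊢ J A C c a a (Refl A a) ≡ c.[a/] : C.[Refl A a .: a .: a .: Var] ]

| trunc_form Γ s A : Γ ⊢ isA s A -> Γ ⊢ isA s (Trunc A)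
| trunc_cong Γ s A A' : Γ ⊢ eqA s A A' -> Γ ⊢ eqA s (Trunc A) (Trunc A')
| tr_intro Γ A a : [ Γ ⊢ A ] -> [ Γ ⊢ a : A ] -> [ Γ ⊢ Tr A a : Trunc A ]
| tr_cong Γ A A' a a' :
    [ Γ ⊢ A ≡ A' ] -> [ Γ ⊢ a ≡ a' : A ] -> [ Γ ⊢ Tr A a ≡ Tr A' a' : Trunc A ]
| trunc_is_prop Γ A :
    [ Γ ⊢ A ] -> [ Γ ⊢ TruncIsProp A : IsProp (Trunc A) ]
| trunc_is_prop_cong Γ A A' :
    [ Γ ⊢ A ≡ A' ] -> [ Γ ⊢ TruncIsProp A ≡ TruncIsProp A' : IsProp (Trunc A) ]
| trunc_rec Γ l A P h f z :
    [ Γ ⊢ A ] -> [ Γ ⊢ P : Univ l ] -> [ Γ ⊢ h : IsProp P ] ->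
    [ Γ ⊢ f : Arr A P ] -> [ Γ ⊢ z : Trunc A ] ->
    [ Γ ⊢ TruncRec A P h f z : P ]
| trunc_rec_cong Γ l A A' P P' h h' f f' z z' :
    [ Γ ⊢ A ≡ A' ] -> [ Γ ⊢ P ≡ P' : Univ l ] -> [ Γ ⊢ h ≡ h' : IsProp P ] ->
    [ Γ ⊢ f ≡ f' : Arr A P ] -> [ Γ ⊢ z ≡ z' : Trunc A ] ->
    [ Γ ⊢ TruncRec A P h f z ≡ TruncRec A' P' h' f' z' : P ]
| trunc_beta Γ l A P h f x :
    [ Γ ⊢ A ] -> [ Γ ⊢ P : Univ l ] -> [ Γ ⊢ h : IsProp P ] ->
    [ Γ ⊢ f : Arr A P ] -> [ Γ ⊢ x : A ] ->
    [ Γ ⊢ TruncRec A P h f (Tr A x) ≡ App f x : P ]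

where "Γ ⊢ j" := (derivable Γ j)
  and "[ ⊢ Γ ]" := (derivable Γ WfCtx)
  and "[ Γ ⊢ A ]" := (derivable Γ (IsType A))
  and "[ Γ ⊢ A ≡ B ]" := (derivable Γ (EqType A B))
  and "[ Γ ⊢ a : A ]" := (derivable Γ (HasType a A))
  and "[ Γ ⊢ a ≡ b : A ]" := (derivable Γ (EqTerm a b A)).

(* Main.v *)
Require Import Defs.

(** For the point [x0], the type [P] of pairs of a pointed type [q] and an
    identification [(X, x0) = q] is contractible, hence a proposition of the
    larger universe.  Transitivity maps [X] into [P] by sending [x] to [(X, x)]
    with its identification, and this map factors through [‖X‖] by [rec].  The
    carrier and the base point of the resulting pointed type are [B z] and
    [myst z]; at [|x|] the computation rule returns [(X, x)] itself, so the two
    projections compute to [X] and [x].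

    The hypotheses live in an arbitrary context while the conclusions live in
    extensions of it, so the argument needs that derivability is stable under
    renaming; stability under substitution is not needed, since all terms are
    typed directly at their instances. *)

(** * Renaming and substitution *)

(* The lemmas take the pointwise equation between renamings or substitutions
   as a premise: it is preserved by [up], and no extensionality is needed. *)

Lemma subst_ext t : forall s s', (forall n, s n = s' n) -> t.[s] = t.[s'].
Proof.
  assert (U : forall s s', (forall n, s n = s' n) ->
    forall n, up s n = up s' n)
    by (intros s s' H [|n]; cbn; [|rewrite H]; auto).
  induction t; intros s s' H; cbn; [apply H|..]; f_equal; auto 6.
Qed.

Lemma subst_id t : forall s, (forall n, s n = Var n) -> t.[s] = t.
Proof.
  assert (U : forall s, (forall n, s n = Var n) ->
    forall n, up s n = Var n)
    by (intros s H [|n]; cbn; [|rewrite H]; auto).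
  induction t; intros s H; cbn; [apply H|..]; f_equal; auto 6.
Qed.

Lemma ren_as_subst t :
  forall r s, (forall n, Var (r n) = s n) -> ren r t = t.[s].
Proof.
  assert (U : forall r s, (forall n, Var (r n) = s n) ->
    forall n, Var (upr r n) = up s n)
    by (intros r s H [|n]; cbn; [|rewrite <- H]; auto).
  induction t; intros r s H; cbn; [apply H|..]; f_equal; auto 6.
Qed.

Lemma subst_ren t :
  forall r s s', (forall n, s (r n) = s' n) -> (ren r t).[s] = t.[s'].
Proof.
  assert (U : forall r s s', (forall n, s (r n) = s' n) ->
    forall n, up s (upr r n) = up s' n)
    by (intros r s s' H [|n]; cbn; [|rewrite H]; auto).
  induction t; intros r s s' H; cbn; [apply H|..]; f_equal; auto 6.
Qed.

(** By [subst_ren] both sides fuse into a single substitution of [t]. The composition laws rest on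
    each other: this equation is the binder case of [ren_subst], and [subst_up_shift], which follows
    from that law, is the binder case of [subst_subst]. *)
Lemma ren_upr_shift t r : ren (upr r) (↑t) = ↑(ren r t).
Proof.
  rewrite (ren_as_subst (↑t) _ (fun n => Var (upr r n))) by reflexivity.
  rewrite (ren_as_subst (ren r t) _ (fun n => Var (S n))) by reflexivity.
  erewrite !subst_ren by reflexivity.
  reflexivity.
Qed.

Lemma ren_subst t :
  forall r s s', (forall n, ren r (s n) = s' n) -> ren r t.[s] = t.[s'].
Proof.
  assert (U : forall r s s', (forall n, ren r (s n) = s' n) ->
    forall n, ren (upr r) (up s n) = up s' n)
    by (intros r s s' H [|n]; cbn; [|rewrite ren_upr_shift, H]; auto).
  induction t; intros r s s' H; cbn; [apply H|..]; f_equal; auto 6.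
Qed.

Lemma subst_up_shift t s : (↑t).[up s] = ↑(t.[s]).
Proof.
  erewrite subst_ren by reflexivity.
  erewrite ren_subst by reflexivity.
  reflexivity.
Qed.

Lemma subst_subst t :
  forall s s' s'', (forall n, (s n).[s'] = s'' n) -> t.[s].[s'] = t.[s''].
Proof.
  assert (U : forall s s' s'', (forall n, (s n).[s'] = s'' n) ->
    forall n, (up s n).[up s'] = up s'' n)
    by (intros s s' s'' H [|n]; cbn; [|rewrite subst_up_shift, H]; auto).
  induction t; intros s s' s'' H; cbn; [apply H|..]; f_equal; auto 6.
Qed.

Lemma ren_substE r t : ren r t = t.[fun n => Var (r n)].
Proof. apply ren_as_subst; reflexivity. Qed.

Lemma subst_substE t s s' : t.[s].[s'] = t.[fun n => (s n).[s']].
Proof. apply subst_subst; reflexivity. Qed.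

Create HintDb syntax.
#[local] Hint Unfold Arr IsProp PtType Pt Transitive : syntax.

(* Decides equality of terms up to the equational theory of substitution: every
   leaf is brought to the form [t.[s]], and substitutions are compared
   pointwise on the first few variables. *)
Ltac term_eq :=
  repeat autounfold with syntax; cbn;
  lazymatch goal with
  | |- ?a = ?a => reflexivity
  | _ =>
    rewrite ?ren_substE, ?subst_substE;
    lazymatch goal with
    | |- ?t.[_] = ?t.[_] => apply subst_ext; pointwise_eq
    | |- ?t.[_] = ?t => apply subst_id; pointwise_eq
    | |- ?t = ?t.[_] => symmetry; apply subst_id; pointwise_eq
    | |- _ => progress f_equal; term_eq
    end
  end
with pointwise_eq :=
  let n := fresh "n" in
  intros n;
  do 6 (try (destruct n as [|n]; [solve [cbn; term_eq] |]));
  cbn; term_eq.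

Lemma subst_shift1 A a : (↑A).[a/] = A.
Proof. term_eq. Qed.

(** * Weakening *)

(** Apart from the two context rules, every rule has a premise over the context of its
    conclusion. *)
Lemma wf_ctx Γ j : Γ ⊢ j -> [ ⊢ Γ ].
Proof. induction 1; auto; constructor; auto. Qed.

Definition renJ (r : nat -> nat) (j : judgment) : judgment :=
  match j with
  | WfCtx => WfCtx
  | IsType A => IsType (ren r A)
  | EqType A B => EqType (ren r A) (ren r B)
  | HasType a A => HasType (ren r a) (ren r A)
  | EqTerm a b A => EqTerm (ren r a) (ren r b) (ren r A)
  end.

(** While [s] is a variable, [isA s A] is stuck and [renJ] cannot compute on it, so the formation
    rules need this as a rewriting step. *)
Lemma renJ_isA r s A : renJ r (isA s A) = isA s (ren r A).
Proof. destruct s; reflexivity. Qed.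

Lemma renJ_eqA r s A B : renJ r (eqA s A B) = eqA s (ren r A) (ren r B).
Proof. destruct s; reflexivity. Qed.

Definition renaming (r : nat -> nat) (Γ Δ : ctx) : Prop :=
  forall n A, lookup Γ n A -> lookup Δ (r n) (ren r A).

Lemma renaming_upr r Γ Δ A :
  renaming r Γ Δ -> renaming (upr r) (Γ ,, A) (Δ ,, ren r A).
Proof.
  intros H n B L. inversion L; subst; cbn; rewrite ren_upr_shift.
  - constructor.
  - constructor; auto.
Qed.

Lemma renaming_shift r Γ Δ A :
  renaming r Γ Δ -> renaming (fun n => S (r n)) Γ (Δ ,, A).
Proof.
  intros H n B L.
  replace (ren (fun n => S (r n)) B) with (↑(ren r B)) by term_eq.
  constructor; auto.
Qed.

(** Renamed rules match their expected conclusions only up to the substitution calculus; this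
    separates the derivation from the syntactic repair. *)
Lemma derivable_eq Γ j j' : Γ ⊢ j -> j = j' -> Γ ⊢ j'.
Proof. intros; subst; auto. Qed.

Ltac judge_eq := repeat autounfold with syntax; cbn; f_equal; term_eq.

(** The first hypothesis is the induction hypothesis for [A] in [derivable_ren]. Used at the shifted
    renaming, it replaces weakening, which is only a corollary of that induction. *)
Lemma type_shift_ren Γ Δ A r :
  (forall r' Δ', [ ⊢ Δ' ] -> renaming r' Γ Δ' -> [ Δ' ⊢ ren r' A ]) ->
  [ ⊢ Δ ] -> renaming r Γ Δ -> [ Δ ,, ren r A ⊢ ↑(ren r A) ].
Proof.
  intros H hΔ hr.
  replace (↑(ren r A)) with (ren (fun n => S (r n)) A) by term_eq.
  apply H; [constructor|apply renaming_shift]; auto.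
Qed.

Lemma endpoints_id_type Γ A :
  [ Γ ⊢ A ] -> [ Γ ,, A ⊢ ↑A ] -> [ Γ ,, A ,, ↑A ⊢ ↑↑A ] ->
  [ Γ ,, A ,, ↑A ⊢ Id (↑↑A) (Var 1) (Var 0) ].
Proof.
  intros h1 h2 h3.
  assert (w : [ ⊢ Γ ,, A ,, ↑A ]) by eauto using ctx_cons, wf_ctx.
  apply (id_form _ None); auto.
  - apply var_intro; auto. repeat constructor.
  - apply var_intro; auto. constructor.
Qed.

(** This is the context of the motive of [J] after renaming; the induction hypothesis for the motive
    applies only once it is known to be well formed. *)
Lemma wf_id_ctx_ren Γ Δ A r :
  (forall r' Δ', [ ⊢ Δ' ] -> renaming r' Γ Δ' -> [ Δ' ⊢ ren r' A ]) ->
  [ ⊢ Δ ] -> renaming r Γ Δ ->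
  [ ⊢ Δ ,, ren r A ,, ↑(ren r A) ,, Id (↑↑(ren r A)) (Var 1) (Var 0) ].
Proof.
  intros H hΔ hr.
  assert (hA := type_shift_ren _ _ _ _ H hΔ hr).
  apply ctx_cons; [eauto using ctx_cons, wf_ctx|].
  apply endpoints_id_type; auto.
  replace (↑↑(ren r A)) with (ren (fun n => S (S (r n))) A) by term_eq.
  apply H; [constructor; eauto using wf_ctx|].
  do 2 apply renaming_shift; auto.
Qed.

Lemma renaming_id_ctx Γ Δ A r :
  renaming r Γ Δ ->
  renaming (upr (upr (upr r))) (Γ ,, A ,, ↑A ,, Id (↑↑A) (Var 1) (Var 0))
    (Δ ,, ren r A ,, ↑(ren r A) ,, Id (↑↑(ren r A)) (Var 1) (Var 0)).
Proof.
  intros hr.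
  replace (Id (↑↑(ren r A)) (Var 1) (Var 0))
    with (ren (upr (upr r)) (Id (↑↑A) (Var 1) (Var 0))) by term_eq.
  rewrite <- (ren_upr_shift A r). auto using renaming_upr.
Qed.

Lemma sig_type Γ A B : [ Γ ⊢ A ] -> [ Γ ,, A ⊢ B ] -> [ Γ ⊢ Sig A B ].
Proof. intros; apply (sig_form _ None); auto. Qed.

Lemma sum_type Γ A B : [ Γ ⊢ A ] -> [ Γ ⊢ B ] -> [ Γ ⊢ Sum A B ].
Proof. intros; apply (sum_form _ None); auto. Qed.

(** The renaming of [Sig] is already computed here, which is the shape that proof search has to
    match. *)
Lemma renaming_sig r Γ Δ A B : renaming r Γ Δ ->
  renaming (upr r) (Γ ,, Sig A B) (Δ ,, Sig (ren r A) (ren (upr r) B)).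
Proof. apply (renaming_upr r Γ Δ (Sig A B)). Qed.

Lemma renaming_sum r Γ Δ A B : renaming r Γ Δ ->
  renaming (upr r) (Γ ,, Sum A B) (Δ ,, Sum (ren r A) (ren r B)).
Proof. apply (renaming_upr r Γ Δ (Sum A B)). Qed.

(** The induction keeps [r] and [Δ] general because premises under a binder use [upr r] and an
    extended target context. *)
Theorem derivable_ren Γ j :
  Γ ⊢ j -> forall r Δ, [ ⊢ Δ ] -> renaming r Γ Δ -> Δ ⊢ renJ r j.
Proof.
  Local Ltac ih :=
    cbn; solve [eauto 20 using ctx_cons, renaming_upr, renaming_sig, renaming_sum,
           sig_type, sum_type,
           wf_id_ctx_ren, renaming_id_ctx].
  (** [by_rule] repairs the conclusion of a rule applied to renamed arguments; [from] repairs an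
      induction hypothesis to fit a premise. *)
  Local Ltac by_rule R :=
    eapply derivable_eq; [eapply R; try ih|judge_eq].
  Local Ltac from IH r Δ :=
    refine (derivable_eq _ _ _ (IH r Δ _ _) _); [ih|ih|judge_eq].
  induction 1; intros r Δ hΔ hr; rewrite ?renJ_isA, ?renJ_eqA;
    repeat match goal with
    | H : forall r Δ, _ -> renaming r ?Γ Δ -> Δ ⊢ renJ r (isA ?s ?A) |- _ =>
        assert (forall r Δ, [ ⊢ Δ ] -> renaming r Γ Δ -> Δ ⊢ isA s (ren r A))
          by (intros; rewrite <- renJ_isA; auto);
        clear H
    | H : forall r Δ, _ -> renaming r ?Γ Δ -> Δ ⊢ renJ r (eqA ?s ?A ?B) |- _ =>
        assert (forall r Δ, [ ⊢ Δ ] -> renaming r Γ Δ ->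
                  Δ ⊢ eqA s (ren r A) (ren r B))
          by (intros; rewrite <- renJ_eqA; auto);
        clear H
    end; cbn in *.
  all: try solve [auto | econstructor; ih].
  all: try first [apply pi_form; ih | apply pi_cong; ih | apply sig_form; ih
    | apply sig_cong; ih | apply sum_form; ih | apply sum_cong; ih
    | apply id_form; ih | apply id_cong; ih | apply trunc_form; ih
    | apply trunc_cong; ih].
  (* Each remaining rule has a substitution or a shift in its conclusion or in a premise, and
     renaming must be commuted past it. *)
  - by_rule (app_elim Δ (ren r A) (ren (upr r) B)).
  - by_rule (app_cong Δ (ren r A) (ren (upr r) B)).
  - by_rule (pi_beta Δ (ren r A) (ren (upr r) B) (ren (upr r) b) (ren r a)).
  - by_rule (pi_eta Δ (ren r A) (ren (upr r) B) (ren r f)).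
  - apply pair_intro; try ih. from IHderivable4 r Δ.
  - apply pair_cong; try ih. from IHderivable5 r Δ.
  - by_rule (sig_elim Δ (ren r A) (ren (upr r) B) (ren (upr r) C)
               (ren (upr (upr r)) g) (ren r p)).
    from IHderivable4 (upr (upr r)) (Δ ,, ren r A ,, ren (upr r) B).
  - by_rule (sig_elim_cong Δ (ren r A) (ren r A') (ren (upr r) B)
      (ren (upr r) B') (ren (upr r) C) (ren (upr r) C')
      (ren (upr (upr r)) g) (ren (upr (upr r)) g') (ren r p) (ren r p')).
    from IHderivable6 (upr (upr r)) (Δ ,, ren r A ,, ren (upr r) B).
  - by_rule (sig_beta Δ (ren r A) (ren (upr r) B) (ren (upr r) C)
               (ren (upr (upr r)) g) (ren r a) (ren r b)).
    + from IHderivable4 (upr (upr r)) (Δ ,, ren r A ,, ren (upr r) B).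
    + from IHderivable6 r Δ.
  - by_rule (sum_elim Δ (ren r A) (ren r B) (ren (upr r) C)
               (ren (upr r) c) (ren (upr r) d) (ren r e)).
    + from IHderivable4 (upr r) (Δ ,, ren r A).
    + from IHderivable5 (upr r) (Δ ,, ren r B).
  - by_rule (sum_elim_cong Δ (ren r A) (ren r A') (ren r B) (ren r B')
      (ren (upr r) C) (ren (upr r) C') (ren (upr r) c) (ren (upr r) c')
      (ren (upr r) d) (ren (upr r) d') (ren r e) (ren r e')).
    + from IHderivable6 (upr r) (Δ ,, ren r A).
    + from IHderivable7 (upr r) (Δ ,, ren r B).
  - by_rule (sum_beta_l Δ (ren r A) (ren r B) (ren (upr r) C)
               (ren (upr r) c) (ren (upr r) d) (ren r a)).
    + from IHderivable4 (upr r) (Δ ,, ren r A).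
    + from IHderivable5 (upr r) (Δ ,, ren r B).
  - by_rule (sum_beta_r Δ (ren r A) (ren r B) (ren (upr r) C)
               (ren (upr r) c) (ren (upr r) d) (ren r b)).
    + from IHderivable4 (upr r) (Δ ,, ren r A).
    + from IHderivable5 (upr r) (Δ ,, ren r B).
  - by_rule (id_elim Δ (ren r A) (ren (upr (upr (upr r))) C) (ren (upr r) c)
               (ren r a) (ren r b) (ren r p)).
    from IHderivable3 (upr r) (Δ ,, ren r A).
  - by_rule (id_elim_cong Δ (ren r A) (ren r A') (ren (upr (upr (upr r))) C)
      (ren (upr (upr (upr r))) C') (ren (upr r) c) (ren (upr r) c')
      (ren r a) (ren r a') (ren r b) (ren r b') (ren r p) (ren r p')).
    from IHderivable4 (upr r) (Δ ,, ren r A).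
  - by_rule (id_beta Δ (ren r A) (ren (upr (upr (upr r))) C) (ren (upr r) c)
               (ren r a)).
    from IHderivable3 (upr r) (Δ ,, ren r A).
  - by_rule (trunc_is_prop Δ (ren r A)).
  - by_rule (trunc_is_prop_cong Δ (ren r A) (ren r A')).
  - apply trunc_rec with l; try ih.
    + from IHderivable3 r Δ.
    + from IHderivable4 r Δ.
  - apply trunc_rec_cong with l; try ih.
    + from IHderivable3 r Δ.
    + from IHderivable4 r Δ.
  - apply trunc_beta with l; try ih.
    + from IHderivable3 r Δ.
    + from IHderivable4 r Δ.
Qed.

Corollary type_wk Γ A B : [ Γ ⊢ B ] -> [ Γ ⊢ A ] -> [ Γ ,, B ⊢ ↑A ].
Proof.
  intros hB hA. apply (derivable_ren _ _ hA S).
  - eauto using ctx_cons, wf_ctx.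
  - intros n C; constructor; auto.
Qed.

Corollary term_wk Γ a A B : [ Γ ⊢ B ] -> [ Γ ⊢ a : A ] -> [ Γ ,, B ⊢ ↑a : ↑A ].
Proof.
  intros hB ha. apply (derivable_ren _ _ ha S).
  - eauto using ctx_cons, wf_ctx.
  - intros n C; constructor; auto.
Qed.

Lemma typed_eq Γ a A A' : [ Γ ⊢ a : A ] -> A = A' -> [ Γ ⊢ a : A' ].
Proof. intros; subst; auto. Qed.

Lemma term_eq_eq Γ a b A A' : [ Γ ⊢ a ≡ b : A ] -> A = A' -> [ Γ ⊢ a ≡ b : A' ].
Proof. intros; subst; auto. Qed.

Ltac typed_var :=
  eapply typed_eq;
  [apply var_intro; [eauto using ctx_cons, wf_ctx|repeat constructor]|term_eq].

(** * Projections *)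

Definition Fst (A B p : term) : term := SigInd A B (↑A) (Var 1) p.

(** The second projection of [PtType]: the motive is the carrier of the pair being eliminated. *)
Definition Base (q : term) : term :=
  SigInd (Univ U0) (Var 0) (Fst (Univ U0) (Var 0) (Var 0)) (Var 0) q.

#[local] Hint Unfold Fst Base : syntax.

Lemma fst_typed Γ A B p :
  [ Γ ⊢ A ] -> [ Γ ,, A ⊢ B ] -> [ Γ ⊢ p : Sig A B ] -> [ Γ ⊢ Fst A B p : A ].
Proof.
  intros hA hB hp.
  eapply typed_eq; [apply sig_elim with (C := ↑A); auto|term_eq].
  - apply type_wk; auto using sig_type.
  - typed_var.
Qed.

Lemma fst_cong Γ A B p p' :
  [ Γ ⊢ A ] -> [ Γ ,, A ⊢ B ] -> [ Γ ⊢ p ≡ p' : Sig A B ] ->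
  [ Γ ⊢ Fst A B p ≡ Fst A B p' : A ].
Proof.
  intros hA hB hp.
  eapply term_eq_eq;
    [apply sig_elim_cong with (C := ↑A) (g := Var 1); eauto using ty_refl|term_eq].
  - apply ty_refl, type_wk; auto using sig_type.
  - apply tm_refl. typed_var.
Qed.

Lemma fst_beta Γ A B a b :
  [ Γ ⊢ A ] -> [ Γ ,, A ⊢ B ] -> [ Γ ⊢ a : A ] -> [ Γ ⊢ b : B.[a/] ] ->
  [ Γ ⊢ Fst A B (Pair A B a b) ≡ a : A ].
Proof.
  intros hA hB ha hb.
  eapply term_eq_eq; [apply sig_beta with (C := ↑A) (g := Var 1); auto|term_eq].
  - apply type_wk; auto using sig_type.
  - typed_var.
Qed.

(** * Carrier and base point of a pointed type *)

Lemma var0_type Γ : [ ⊢ Γ ] -> [ Γ ,, Univ U0 ⊢ Var 0 ].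
Proof.
  intros w. apply univ_el with U0.
  typed_var. auto using ctx_cons, univ_type.
Qed.

Lemma ptType_typed Γ : [ ⊢ Γ ] -> [ Γ ⊢ PtType : Univ U1 ].
Proof.
  intros w. apply (sig_form _ (Some U1)); cbn.
  - auto using univ_type.
  - auto using univ_in.
  - apply univ_cumul. typed_var. auto using ctx_cons, univ_type.
Qed.

Lemma ptType_type Γ : [ ⊢ Γ ] -> [ Γ ⊢ PtType ].
Proof. eauto using univ_el, ptType_typed. Qed.

Lemma pt_typed Γ A a :
  [ Γ ⊢ A : Univ U0 ] -> [ Γ ⊢ a : A ] -> [ Γ ⊢ Pt A a : PtType ].
Proof.
  intros hA ha. assert (w := wf_ctx _ _ hA).
  apply pair_intro; auto using univ_type, var0_type.
Qed.

Lemma carrier_typed Γ q :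
  [ Γ ⊢ q : PtType ] -> [ Γ ⊢ Fst (Univ U0) (Var 0) q : Univ U0 ].
Proof.
  intros hq. assert (w := wf_ctx _ _ hq).
  apply fst_typed; auto using univ_type, var0_type.
Qed.

Lemma carrier_pt Γ A a :
  [ Γ ⊢ A : Univ U0 ] -> [ Γ ⊢ a : A ] ->
  [ Γ ⊢ Fst (Univ U0) (Var 0) (Pt A a) ≡ A : Univ U0 ].
Proof.
  intros hA ha. assert (w := wf_ctx _ _ hA).
  apply fst_beta; auto using univ_type, var0_type.
Qed.

Lemma base_motive Γ :
  [ ⊢ Γ ] -> [ Γ ,, PtType ⊢ Fst (Univ U0) (Var 0) (Var 0) ].
Proof.
  intros w. apply univ_el with U0, carrier_typed.
  typed_var. auto using ctx_cons, ptType_type.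
Qed.

(** The second component has type [Var 1], and the computation rule of the first projection makes
    this the carrier of the pair; conversion does the rest. *)
Lemma base_method Γ :
  [ ⊢ Γ ] ->
  [ Γ ,, Univ U0 ,, Var 0
      ⊢ Var 0 : Fst (Univ U0) (Var 0) (Pt (Var 1) (Var 0)) ].
Proof.
  intros w.
  assert (w' : [ ⊢ Γ ,, Univ U0 ,, Var 0 ])
    by auto using ctx_cons, univ_type, var0_type.
  assert (h : [ Γ ,, Univ U0 ,, Var 0 ⊢ Var 0 : Var 1 ]) by typed_var.
  apply tm_conv with (Var 1); auto.
  apply ty_sym, univ_el_eq with U0, carrier_pt; auto.
  typed_var.
Qed.

Lemma base_typed Γ q :
  [ Γ ⊢ q : PtType ] -> [ Γ ⊢ Base q : Fst (Univ U0) (Var 0) q ].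
Proof.
  intros hq. assert (w := wf_ctx _ _ hq).
  eapply typed_eq; [eapply sig_elim|]; eauto using univ_type, var0_type.
  - apply base_motive; auto.
  - apply base_method; auto.
Qed.

Lemma base_cong Γ q q' :
  [ Γ ⊢ q ≡ q' : PtType ] ->
  [ Γ ⊢ Base q ≡ Base q' : Fst (Univ U0) (Var 0) q ].
Proof.
  intros hq. assert (w := wf_ctx _ _ hq).
  eapply term_eq_eq; [eapply sig_elim_cong|];
    eauto using univ_type, var0_type, ty_refl.
  - apply ty_refl, base_motive; auto.
  - apply tm_refl, base_method; auto.
Qed.

Lemma base_pt Γ A a :
  [ Γ ⊢ A : Univ U0 ] -> [ Γ ⊢ a : A ] -> [ Γ ⊢ Base (Pt A a) ≡ a : A ].
Proof.
  intros hA ha. assert (w := wf_ctx _ _ hA).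
  (* [sig_beta] gives the equation at the carrier of [Pt A a], which is judgmentally [A]. *)
  eapply tm_eq_conv; [|eapply univ_el_eq, carrier_pt; eauto].
  eapply term_eq_eq; [eapply sig_beta|]; eauto using univ_type, var0_type.
  - apply base_motive; auto.
  - apply base_method; auto.
Qed.

(** * Based path spaces are propositions *)

Definition pathFib (A a : term) : term := Id (↑A) (↑a) (Var 0).
Definition PathTo (A a : term) : term := Sig A (pathFib A a).
Definition pathPt (A a b p : term) : term := Pair A (pathFib A a) b p.
Definition center (A a : term) : term := pathPt A a a (Refl A a).

#[local] Hint Unfold pathFib PathTo pathPt center : syntax.

Lemma id_type Γ A a b :
  [ Γ ⊢ A ] -> [ Γ ⊢ a : A ] -> [ Γ ⊢ b : A ] -> [ Γ ⊢ Id A a b ].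
Proof. intros; apply (id_form _ None); auto. Qed.

Lemma pathFib_type Γ A a :
  [ Γ ⊢ A ] -> [ Γ ⊢ a : A ] -> [ Γ ,, A ⊢ pathFib A a ].
Proof.
  intros. apply id_type; auto 10 using type_wk, term_wk. typed_var.
Qed.

Lemma pathTo_type Γ A a : [ Γ ⊢ A ] -> [ Γ ⊢ a : A ] -> [ Γ ⊢ PathTo A a ].
Proof. intros; apply sig_type; auto using pathFib_type. Qed.

Lemma pathFib_subst A a b : (pathFib A a).[b/] = Id A a b.
Proof. term_eq. Qed.

Lemma pathPt_typed Γ A a b p :
  [ Γ ⊢ A ] -> [ Γ ⊢ a : A ] -> [ Γ ⊢ b : A ] -> [ Γ ⊢ p : Id A a b ] ->
  [ Γ ⊢ pathPt A a b p : PathTo A a ].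
Proof.
  intros. apply pair_intro; auto using pathFib_type.
  rewrite pathFib_subst; auto.
Qed.

Lemma center_typed Γ A a :
  [ Γ ⊢ A ] -> [ Γ ⊢ a : A ] -> [ Γ ⊢ center A a : PathTo A a ].
Proof. intros; apply pathPt_typed; auto using refl_intro. Qed.

(** In the motive the base point is [Var 2] and varies as well, since [J] quantifies over both
    endpoints. On reflexivity the pair is the center itself. *)
Definition contractPath (A a b p : term) : term :=
  J A (Id (PathTo (↑↑↑A) (Var 2)) (center (↑↑↑A) (Var 2))
         (pathPt (↑↑↑A) (Var 2) (Var 1) (Var 0)))
    (Refl (PathTo (↑A) (Var 0)) (center (↑A) (Var 0))) a b p.

#[local] Hint Unfold contractPath : syntax.

Lemma id_ctx_wk Γ A :
  [ Γ ⊢ A ] -> [ Γ ,, A ,, ↑A ⊢ Id (↑↑A) (Var 1) (Var 0) ].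
Proof. intros; apply endpoints_id_type; auto using type_wk. Qed.

Lemma contractPath_typed Γ A a b p :
  [ Γ ⊢ A ] -> [ Γ ⊢ a : A ] -> [ Γ ⊢ b : A ] -> [ Γ ⊢ p : Id A a b ] ->
  [ Γ ⊢ contractPath A a b p
      : Id (PathTo A a) (center A a) (pathPt A a b p) ].
Proof.
  intros hA ha hb hp.
  assert (hI := id_ctx_wk _ _ hA).
  assert (hA3 : [ Γ ,, A ,, ↑A ,, Id (↑↑A) (Var 1) (Var 0) ⊢ ↑↑↑A ])
    by auto 10 using type_wk.
  eapply typed_eq; [apply id_elim; eauto|term_eq].
  - assert (h2 : [ Γ ,, A ,, ↑A ,, Id (↑↑A) (Var 1) (Var 0)
                     ⊢ Var 2 : ↑↑↑A ]) by typed_var.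
    apply id_type; auto using pathTo_type, center_typed.
    apply pathPt_typed; auto; typed_var.
  - assert (h0 : [ Γ ,, A ⊢ Var 0 : ↑A ]) by typed_var.
    eapply typed_eq; [apply refl_intro|term_eq];
      auto 10 using pathTo_type, center_typed, type_wk.
Qed.

(** Splitting [u] into a pair reduces the contraction to [contractPath]. *)
Definition contract (A a u : term) : term :=
  SigInd A (pathFib A a) (Id (↑(PathTo A a)) (↑(center A a)) (Var 0))
    (contractPath (↑↑A) (↑↑a) (Var 1) (Var 0)) u.

(** This is the path $p^{-1}\cdot q$. Induction on [p] proves the implication from $u=w$ to $v=w$,
    which is the identity on reflexivity. The second [Var 2] lies under the binder of [Pi] and so
    denotes [v], whereas the first denotes [u]. *)
Definition invComp (A u v w p q : term) : term :=
  App (J A (Pi (Id (↑↑↑A) (Var 2) (↑↑↑w)) (Id (↑↑↑↑A) (Var 2) (↑↑↑↑w)))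
         (Lam (Id (↑A) (Var 0) (↑w)) (Var 0)) u v p) q.

(** Any two elements are joined through the center. *)
Definition pathToIsProp (A a : term) : term :=
  Lam (PathTo A a) (Lam (↑(PathTo A a))
    (invComp (↑↑(PathTo A a)) (↑↑(center A a)) (Var 1) (Var 0)
       (contract (↑↑A) (↑↑a) (Var 1)) (contract (↑↑A) (↑↑a) (Var 0)))).

#[local] Hint Unfold contract invComp pathToIsProp : syntax.

Lemma contract_typed Γ A a u :
  [ Γ ⊢ A ] -> [ Γ ⊢ a : A ] -> [ Γ ⊢ u : PathTo A a ] ->
  [ Γ ⊢ contract A a u : Id (PathTo A a) (center A a) u ].
Proof.
  intros hA ha hu.
  assert (hF := pathFib_type _ _ _ hA ha).
  assert (hP := pathTo_type _ _ _ hA ha).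
  eapply typed_eq; [apply sig_elim; auto|term_eq].
  - apply id_type; auto 10 using type_wk, term_wk, center_typed. typed_var.
  - eapply typed_eq; [apply contractPath_typed|term_eq];
      auto 10 using type_wk, term_wk; typed_var.
Qed.

Lemma invComp_typed Γ A u v w p q :
  [ Γ ⊢ A ] -> [ Γ ⊢ u : A ] -> [ Γ ⊢ v : A ] -> [ Γ ⊢ w : A ] ->
  [ Γ ⊢ p : Id A u v ] -> [ Γ ⊢ q : Id A u w ] ->
  [ Γ ⊢ invComp A u v w p q : Id A v w ].
Proof.
  intros hA hu hv hw hp hq.
  assert (hI := id_ctx_wk _ _ hA).
  assert (hA3 : [ Γ ,, A ,, ↑A ,, Id (↑↑A) (Var 1) (Var 0) ⊢ ↑↑↑A ])
    by auto 10 using type_wk.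
  eapply typed_eq;
    [eapply app_elim with (A := Id A u w) (B := ↑(Id A v w)); auto|term_eq].
  eapply typed_eq; [apply id_elim; auto|term_eq].
  - assert (hw3 : [ Γ ,, A ,, ↑A ,, Id (↑↑A) (Var 1) (Var 0) ⊢ ↑↑↑w : ↑↑↑A ])
      by auto 10 using type_wk, term_wk.
    assert (h : [ Γ ,, A ,, ↑A ,, Id (↑↑A) (Var 1) (Var 0)
                   ⊢ Id (↑↑↑A) (Var 2) (↑↑↑w) ])
      by (apply id_type; auto; typed_var).
    apply (pi_form _ None); cbn; auto.
    apply id_type; auto 10 using type_wk, term_wk. typed_var.
  - assert (h : [ Γ ,, A ⊢ Id (↑A) (Var 0) (↑w) ])
      by (apply id_type; auto 10 using type_wk, term_wk; typed_var).
    eapply typed_eq; [apply lam_intro with (B := Id (↑↑A) (Var 1) (↑↑w)); auto; typed_var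
      |term_eq].
Qed.

Lemma pathToIsProp_typed Γ A a :
  [ Γ ⊢ A ] -> [ Γ ⊢ a : A ] -> [ Γ ⊢ pathToIsProp A a : IsProp (PathTo A a) ].
Proof.
  intros hA ha.
  assert (hP := pathTo_type _ _ _ hA ha).
  assert (hc := center_typed _ _ _ hA ha).
  apply lam_intro; auto. apply lam_intro; auto 10 using type_wk.
  assert (hP1 : [ Γ ,, PathTo A a ⊢ ↑(PathTo A a) ]) by auto using type_wk.
  assert (h1 : [ Γ ,, PathTo A a ,, ↑(PathTo A a)
                   ⊢ Var 1 : ↑↑(PathTo A a) ])
    by typed_var.
  assert (h0 : [ Γ ,, PathTo A a ,, ↑(PathTo A a)
                   ⊢ Var 0 : ↑↑(PathTo A a) ])
    by typed_var.
  apply invComp_typed; auto 10 using type_wk, term_wk.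
  - eapply typed_eq; [apply contract_typed|term_eq];
      auto 10 using type_wk, term_wk.
    (* Shifting commutes with [PathTo], which brings the type of [h1] to the required form. *)
    refine (typed_eq _ _ _ _ h1 _). term_eq.
  - eapply typed_eq; [apply contract_typed|term_eq];
      auto 10 using type_wk, term_wk.
    refine (typed_eq _ _ _ _ h0 _). term_eq.
Qed.

(** * The mysterious function *)

Definition toPath (X x0 t : term) : term :=
  Lam X (pathPt PtType (↑(Pt X x0)) (Pt (↑X) (Var 0))
           (App (App (↑t) (↑x0)) (Var 0))).

Definition pointed (X x0 t z : term) : term :=
  Fst PtType (pathFib PtType (Pt X x0))
    (TruncRec X (PathTo PtType (Pt X x0)) (pathToIsProp PtType (Pt X x0))
       (toPath X x0 t) z).

Definition mystFam (X x0 t : term) : term :=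
  Lam (Trunc X)
    (Fst (Univ U0) (Var 0) (pointed (↑X) (↑x0) (↑t) (Var 0))).

Definition mystFun (X x0 t : term) : term :=
  Lam (Trunc X) (Base (pointed (↑X) (↑x0) (↑t) (Var 0))).

#[local] Hint Unfold toPath pointed mystFam mystFun : syntax.

Lemma pointed_subst X x0 t z s :
  (pointed X x0 t z).[s] = pointed X.[s] x0.[s] t.[s] z.[s].
Proof. term_eq. Qed.

Lemma pointed_ren X x0 t z r :
  ren r (pointed X x0 t z) = pointed (ren r X) (ren r x0) (ren r t) (ren r z).
Proof. rewrite !ren_substE. apply pointed_subst. Qed.

Lemma mystFam_ren X x0 t r :
  ren r (mystFam X x0 t) = mystFam (ren r X) (ren r x0) (ren r t).
Proof.
  (* The renaming is computed only as far as [pointed], which stays folded so that [pointed_ren]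
     applies. *)
  change (ren r (mystFam X x0 t)) with
    (Lam (Trunc (ren r X)) (Fst (Univ U0) (Var 0)
       (ren (upr r) (pointed (↑X) (↑x0) (↑t) (Var 0))))).
  rewrite pointed_ren, !ren_upr_shift. reflexivity.
Qed.

Lemma mystFun_ren X x0 t r :
  ren r (mystFun X x0 t) = mystFun (ren r X) (ren r x0) (ren r t).
Proof.
  change (ren r (mystFun X x0 t)) with
    (Lam (Trunc (ren r X)) (Base
       (ren (upr r) (pointed (↑X) (↑x0) (↑t) (Var 0))))).
  rewrite pointed_ren, !ren_upr_shift. reflexivity.
Qed.

(** Bundling the hypotheses lets them be weakened together, and so used again under a binder. *)
Definition transitive_pointed (Γ : ctx) (X x0 t : term) : Prop :=
  [ Γ ⊢ X : Univ U0 ] /\ [ Γ ⊢ x0 : X ] /\ [ Γ ⊢ t : Transitive X ].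

Lemma transitive_pointed_wk Γ X x0 t A :
  [ Γ ⊢ A ] -> transitive_pointed Γ X x0 t ->
  transitive_pointed (Γ ,, A) (↑X) (↑x0) (↑t).
Proof.
  intros hA [hX [h0 ht]]. split; [|split].
  - apply (term_wk _ _ _ _ hA hX).
  - apply term_wk; auto.
  - eapply typed_eq; [apply term_wk; eauto|term_eq].
Qed.

(** * Typing and computation of the map from the truncation to pointed types *)

Lemma transport_typed Γ X x0 t x :
  transitive_pointed Γ X x0 t -> [ Γ ⊢ x : X ] ->
  [ Γ ⊢ App (App t x0) x : Id PtType (Pt X x0) (Pt X x) ].
Proof.
  intros [hX [h0 ht]] hx.
  eapply typed_eq;
    [apply app_elim with (A := X)
       (B := Id PtType (Pt (↑X) (↑x0)) (Pt (↑X) (Var 0))); auto|term_eq].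
  eapply typed_eq; [eapply app_elim; [exact ht|auto]|term_eq].
Qed.

Lemma toPath_body_typed Γ X x0 t x :
  transitive_pointed Γ X x0 t -> [ Γ ⊢ x : X ] ->
  [ Γ ⊢ pathPt PtType (Pt X x0) (Pt X x) (App (App t x0) x)
      : PathTo PtType (Pt X x0) ].
Proof.
  intros h hx. assert (w := wf_ctx _ _ hx).
  assert (ht := transport_typed _ _ _ _ _ h hx).
  destruct h as [hX [h0 _]].
  apply pathPt_typed; auto using pt_typed, ptType_type.
Qed.

Lemma toPath_lam_typed Γ X x0 t :
  transitive_pointed Γ X x0 t ->
  [ Γ ,, X ⊢ pathPt PtType (↑(Pt X x0)) (Pt (↑X) (Var 0))
               (App (App (↑t) (↑x0)) (Var 0))
      : ↑(PathTo PtType (Pt X x0)) ].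
Proof.
  intros h. assert (hX : [ Γ ⊢ X ]) by (eapply univ_el, h).
  eapply typed_eq;
    [apply toPath_body_typed; [apply transitive_pointed_wk; eauto|typed_var]
    |term_eq].
Qed.

Lemma toPath_typed Γ X x0 t :
  transitive_pointed Γ X x0 t ->
  [ Γ ⊢ toPath X x0 t : Arr X (PathTo PtType (Pt X x0)) ].
Proof.
  intros h. apply lam_intro; [eapply univ_el, h|].
  apply toPath_lam_typed; auto.
Qed.

Lemma toPath_beta Γ X x0 t x :
  transitive_pointed Γ X x0 t -> [ Γ ⊢ x : X ] ->
  [ Γ ⊢ App (toPath X x0 t) x
      ≡ pathPt PtType (Pt X x0) (Pt X x) (App (App t x0) x)
      : PathTo PtType (Pt X x0) ].
Proof.
  intros h hx. assert (hX : [ Γ ⊢ X ]) by (eapply univ_el, h).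
  refine (derivable_eq _ _ _
    (pi_beta _ _ _ _ _ hX (toPath_lam_typed _ _ _ _ h) hx) _).
  judge_eq.
Qed.

(** [trunc_rec] eliminates only into elements of a universe. Since [PtType] quantifies over
    [Univ U0], the target lies in [Univ U1]. *)
Lemma pathTo_pt_typed Γ X x0 t :
  transitive_pointed Γ X x0 t -> [ Γ ⊢ PathTo PtType (Pt X x0) : Univ U1 ].
Proof.
  intros [hX [h0 _]]. assert (w := wf_ctx _ _ h0).
  assert (hQ := ptType_type _ w).
  assert (hp := pt_typed _ _ _ hX h0).
  apply (sig_form _ (Some U1)); cbn; auto using ptType_typed.
  apply (id_form _ (Some U1)); cbn.
  - apply ptType_typed; auto using ctx_cons.
  - apply (term_wk _ _ _ _ hQ hp).
  - typed_var.
Qed.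

Lemma pointed_typed Γ X x0 t z :
  transitive_pointed Γ X x0 t -> [ Γ ⊢ z : Trunc X ] ->
  [ Γ ⊢ pointed X x0 t z : PtType ].
Proof.
  intros h hz. assert (w := wf_ctx _ _ hz).
  assert (hP := pathTo_pt_typed _ _ _ _ h).
  assert (hf := toPath_typed _ _ _ _ h).
  destruct h as [hX [h0 _]].
  apply fst_typed; auto using ptType_type, pathFib_type, pt_typed.
  apply trunc_rec with U1;
    eauto using univ_el, pathToIsProp_typed, ptType_type, pt_typed.
Qed.

(** Three computation rules are chained: [trunc_beta] on [Tr X x], beta reduction of [toPath], and
    the first projection of the resulting pair. The judgmental rule for [rec] enters the
    construction here. *)
Lemma pointed_tr Γ X x0 t x :
  transitive_pointed Γ X x0 t -> [ Γ ⊢ x : X ] ->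
  [ Γ ⊢ pointed X x0 t (Tr X x) ≡ Pt X x : PtType ].
Proof.
  intros h hx. assert (w := wf_ctx _ _ hx).
  assert (hP := pathTo_pt_typed _ _ _ _ h).
  assert (hf := toPath_typed _ _ _ _ h).
  assert (hb := toPath_beta _ _ _ _ _ h hx).
  assert (ht := transport_typed _ _ _ _ _ h hx).
  destruct h as [hX [h0 _]].
  eapply tm_trans.
  - apply fst_cong; auto using ptType_type, pathFib_type, pt_typed.
    eapply tm_trans; [|exact hb].
    apply trunc_beta with U1;
      eauto using univ_el, pathToIsProp_typed, ptType_type, pt_typed.
  - apply fst_beta; auto using ptType_type, pathFib_type, pt_typed.
    rewrite pathFib_subst; auto.
Qed.

(** * The family over the truncation and its section *)

Lemma pointed_var_typed Γ X x0 t :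
  transitive_pointed Γ X x0 t ->
  [ Γ ⊢ Trunc X ] /\
  [ Γ ,, Trunc X ⊢ pointed (↑X) (↑x0) (↑t) (Var 0) : PtType ].
Proof.
  intros h.
  assert (hT : [ Γ ⊢ Trunc X ])
    by (apply (trunc_form _ None); eapply univ_el, h).
  split; auto.
  apply pointed_typed; [apply transitive_pointed_wk; auto|typed_var].
Qed.

(** Read from right to left, this shows the value at [z] as an instance of the body, the form in
    which [pi_beta] and [app_elim] produce it. *)
Lemma pointed_var_subst X x0 t z :
  (pointed (↑X) (↑x0) (↑t) (Var 0)).[z/] = pointed X x0 t z.
Proof. rewrite pointed_subst, !subst_shift1. reflexivity. Qed.

Lemma mystFam_typed Γ X x0 t :
  transitive_pointed Γ X x0 t ->
  [ Γ ⊢ mystFam X x0 t : Arr (Trunc X) (Univ U0) ].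
Proof.
  intros h. destruct (pointed_var_typed _ _ _ _ h) as [hT hp].
  apply lam_intro; auto. apply carrier_typed; auto.
Qed.

Lemma mystFam_beta Γ X x0 t z :
  transitive_pointed Γ X x0 t -> [ Γ ⊢ z : Trunc X ] ->
  [ Γ ⊢ App (mystFam X x0 t) z
      ≡ Fst (Univ U0) (Var 0) (pointed X x0 t z) : Univ U0 ].
Proof.
  intros h hz. destruct (pointed_var_typed _ _ _ _ h) as [hT hp].
  rewrite <- pointed_var_subst.
  exact (pi_beta _ _ _ _ _ hT (carrier_typed _ _ hp) hz).
Qed.

Lemma carrier_pointed_tr Γ X x0 t x :
  transitive_pointed Γ X x0 t -> [ Γ ⊢ x : X ] ->
  [ Γ ⊢ Fst (Univ U0) (Var 0) (pointed X x0 t (Tr X x)) ≡ X : Univ U0 ].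
Proof.
  intros h hx. assert (w := wf_ctx _ _ hx).
  eapply tm_trans; [|apply carrier_pt; [apply h|exact hx]].
  apply fst_cong; auto using univ_type, var0_type, pointed_tr.
Qed.

Lemma tr_typed Γ X x0 t x :
  transitive_pointed Γ X x0 t -> [ Γ ⊢ x : X ] -> [ Γ ⊢ Tr X x : Trunc X ].
Proof. intros h hx. apply tr_intro; auto. eapply univ_el, h. Qed.

Lemma mystFam_tr Γ X x0 t x :
  transitive_pointed Γ X x0 t -> [ Γ ⊢ x : X ] ->
  [ Γ ⊢ App (mystFam X x0 t) (Tr X x) ≡ X : Univ U0 ].
Proof.
  intros h hx.
  eapply tm_trans; [apply mystFam_beta|apply carrier_pointed_tr];
    eauto using tr_typed.
Qed.

(** Here the codomain is the beta-reduced form of [B z]. The type with the applied family and the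
    type at [Tr X x] are both reached from it by conversion. *)
Lemma mystFun_carrier_typed Γ X x0 t :
  transitive_pointed Γ X x0 t ->
  [ Γ ⊢ mystFun X x0 t
      : Pi (Trunc X)
          (Fst (Univ U0) (Var 0) (pointed (↑X) (↑x0) (↑t) (Var 0))) ].
Proof.
  intros h. destruct (pointed_var_typed _ _ _ _ h) as [hT hp].
  apply lam_intro; auto. apply base_typed; auto.
Qed.

Lemma mystFun_typed Γ X x0 t :
  transitive_pointed Γ X x0 t ->
  [ Γ ⊢ mystFun X x0 t : Pi (Trunc X) (App (↑(mystFam X x0 t)) (Var 0)) ].
Proof.
  intros h. destruct (pointed_var_typed _ _ _ _ h) as [hT hp].
  eapply tm_conv; [apply mystFun_carrier_typed; auto|].
  apply (pi_cong _ None); auto using ty_refl.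
  apply ty_sym, univ_el_eq with U0. rewrite mystFam_ren.
  apply mystFam_beta; [apply transitive_pointed_wk; auto|typed_var].
Qed.

Lemma mystFun_tr_typed Γ X x0 t x :
  transitive_pointed Γ X x0 t -> [ Γ ⊢ x : X ] ->
  [ Γ ⊢ App (mystFun X x0 t) (Tr X x) : X ].
Proof.
  intros h hx.
  eapply tm_conv; [|eapply univ_el_eq, carrier_pointed_tr; eauto].
  rewrite <- pointed_var_subst.
  exact (app_elim _ _ _ _ _ (mystFun_carrier_typed _ _ _ _ h)
           (tr_typed _ _ _ _ _ h hx)).
Qed.

Lemma mystFun_tr Γ X x0 t x :
  transitive_pointed Γ X x0 t -> [ Γ ⊢ x : X ] ->
  [ Γ ⊢ App (mystFun X x0 t) (Tr X x) ≡ x : X ].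
Proof.
  intros h hx. destruct (pointed_var_typed _ _ _ _ h) as [hT hp].
  eapply tm_trans; [|apply base_pt; [apply h|exact hx]].
  (* The beta step and [base_cong] hold at the carrier of [pointed X x0 t (Tr X x)], so the type is
     first converted from [X] to that carrier. *)
  eapply tm_eq_conv; [|eapply univ_el_eq, carrier_pointed_tr; eauto].
  eapply tm_trans; [|apply base_cong, pointed_tr; auto].
  rewrite <- pointed_var_subst.
  exact (pi_beta _ _ _ _ _ hT (base_typed _ _ hp) (tr_typed _ _ _ _ _ h hx)).
Qed.

Theorem theorem8p12 (Γ : ctx) (X x0 t : term)
  (hX : [ Γ ⊢ X : Univ U0 ]) (hx0 : [ Γ ⊢ x0 : X ])
  (ht : [ Γ ⊢ t : Transitive X ]) :
  exists B myst : term,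
    [ Γ ⊢ B : Arr (Trunc X) (Univ U0) ] /\
    [ Γ ,, X ⊢ App (↑B) (Tr (↑X) (Var 0)) ≡ ↑X : Univ U0 ] /\
    [ Γ ⊢ myst : Pi (Trunc X) (App (↑B) (Var 0)) ] /\
    [ Γ ⊢ Lam X (App (↑myst) (Tr (↑X) (Var 0))) : Arr X X ] /\
    [ Γ ,, X ⊢ App (↑myst) (Tr (↑X) (Var 0)) ≡ Var 0 : ↑X ] /\
    [ Γ ⊢ Lam X (Refl (↑X) (Var 0))
        : Pi X (Id (↑X) (App (↑myst) (Tr (↑X) (Var 0))) (Var 0)) ].
Proof.
  assert (h : transitive_pointed Γ X x0 t) by (repeat split; auto).
  assert (hT : [ Γ ⊢ X ]) by (eapply univ_el; eauto).
  (* The generic element of [X] is [Var 0] over the extended context, so the pointwise lemmas are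
     used on the weakened data with this variable as [x]. *)
  assert (h' := transitive_pointed_wk _ _ _ _ _ hT h).
  assert (hv : [ Γ ,, X ⊢ Var 0 : ↑X ]) by typed_var.
  exists (mystFam X x0 t), (mystFun X x0 t).
  split; [|split; [|split; [|split; [|split]]]].
  - apply mystFam_typed; auto.
  - rewrite mystFam_ren. apply mystFam_tr; auto.
  - apply mystFun_typed; auto.
  - rewrite mystFun_ren. apply lam_intro; auto.
    apply mystFun_tr_typed; auto.
  - rewrite mystFun_ren. apply mystFun_tr; auto.
  - rewrite mystFun_ren. apply lam_intro; auto.
    (* Reflexivity proves $x=x$; the judgmental equality of [myst] at [Tr] with [x] turns this type
       into the required one. *)
    apply tm_conv with (Id (↑X) (Var 0) (Var 0)).
    + apply refl_intro; auto using type_wk.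
    + apply (id_cong _ None); cbn; auto using ty_refl, tm_refl, type_wk.
      apply tm_sym, mystFun_tr; auto.
Qed.
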